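(* Assume each $f_i$ is strongly convex with constant $\mu_i>0$ and differentiable, $i=1,\dots,m$. Assume that the optimal values of the primal problem (P) and the dual problem (D) are attained, at $\mathbf{y}^\star$ and $\boldsymbol{\lambda}^\star$ respectively, and that strong duality $f(\mathbf{y}^\star)=g(\boldsymbol{\lambda}^\star)$ holds. Let $\mu=\min_i\mu_i$, $L_h=(1/\mu)(2+2\cos(\pi/m))$, and let $D\ge0$. Then there is a function $\rho_1:[0,\infty)\to[0,\infty)$, depending only on the problem data and $D$, with $\rho_1(\epsilon)\to0$ as $\epsilon\to0$, such that the following holds. Let $\{\boldsymbol{\lambda}^{(k)}\}_{k\ge0}$ and $\{\mathbf{y}^{(k)}\}_{k\ge0}$ be the sequences of Lagrange multipliers and primal variables generated by the inexact dual algorithm with distortions satisfying $\|\mathbf{r}_i^{(k)}\|\le\varepsilon_i$ for all $i,k$, and with stepsizes satisfying $0<\gamma_k\le1/L_h$ for all $k$ and $\sum_{k=0}^\infty\gamma_k=\infty$; let $\tilde{\mathbf{y}}^{(k)}=\frac1m(\mathbf{1}_{m\times m}\otimes\mathbf{I}_n)\,\mathbf{y}^{(k)}$ be the resulting primal feasible points; and suppose $\|\boldsymbol{\lambda}^{(k)}-\boldsymbol{\lambda}^\star\|\le D$ for all $k$. Then: 1. $\displaystyle\limsup_k\ \min_{i\in\{0,\dots,k\}}\|\tilde{\mathbf{y}}^{(i)}-\mathbf{y}^\star\|\le\rho_1(\epsilon)$. 2. If $\gamma_k=\gamma/(k+1)^p$ with $0<\gamma\le1/L_h$ and $0\le p\le1$,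 then there is a constant $C$ (independent of $k$) such that for all sufficiently large $k$, $$\min_{i\in\{0,\dots,k\}}\|\tilde{\mathbf{y}}^{(i)}-\mathbf{y}^\star\|\le C\,a_k+\rho_1(\epsilon),$$ where $a_k=1/\sqrt[4]{k^{1-p}}$ if $p\in[0,1)$ and $a_k=1/\sqrt[4]{\log k}$ if $p=1$. Among these bounds the best order is $O(1/\sqrt[4]{k})$, achieved when $p=0$.
   Context: Let $m\ge2$, $n\ge1$ be integers, $\mathcal{Y}\subseteq\mathbb{R}^n$ a closed convex set, and $f_i:\mathbb{R}^n\to\mathbb{R}$, $i=1,\dots,m$, strictly convex closed functions. For $\mathbf{y}=(\mathbf{y}_1,\dots,\mathbf{y}_m)\in(\mathbb{R}^n)^m=\mathbb{R}^{nm}$ put $f(\mathbf{y})=\sum_{i=1}^m f_i(\mathbf{y}_i)$, and let $\bar{\mathcal{Y}}=\mathcal{Y}^m$. Let $\mathbf{A}\in\mathbb{R}^{n(m-1)\times nm}$ be the linear map $\mathbf{A}\mathbf{y}=(\mathbf{y}_1-\mathbf{y}_2,\dots,\mathbf{y}_{m-1}-\mathbf{y}_m)$. $\mathbf{1}_{m\times m}$ is the all-ones matrix, $\otimes$ the Kronecker product; thus every block of $\tilde{\mathbf{y}}^{(k)}$ equals the average $\frac1m\sum_i\mathbf{y}_i^{(k)}$. Primal problem (P): minimize $f(\mathbf{y})$ subject to $\mathbf{y}\in\bar{\mathcal{Y}}$, $\mathbf{A}\mathbf{y}=\mathbf{0}$. Dual function: $g(\boldsymbol{\lambda})=\inf_{\mathbf{y}\in\bar{\mathcal{Y}}}\big[f(\mathbf{y})+\boldsymbol{\lambda}^{T}\mathbf{A}\mathbf{y}\big]$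 for $\boldsymbol{\lambda}\in\mathbb{R}^{n(m-1)}$. Dual problem (D): maximize $g(\boldsymbol{\lambda})$ over $\boldsymbol{\lambda}\in\mathbb{R}^{n(m-1)}$. The problem data are $m$, $n$, $\mathcal{Y}$, $f_1,\dots,f_m$. Inexact dual algorithm: start from any $\boldsymbol{\lambda}^{(0)}\in\mathbb{R}^{n(m-1)}$; for $k=0,1,2,\dots$ let $\mathbf{y}^{(k)}=\arg\min_{\mathbf{y}\in\bar{\mathcal{Y}}}\big[f(\mathbf{y})+(\boldsymbol{\lambda}^{(k)})^{T}\mathbf{A}\mathbf{y}\big]$, let $\hat{\mathbf{y}}_i^{(k)}=\mathbf{y}_i^{(k)}+\mathbf{r}_i^{(k)}$ where $\mathbf{r}_i^{(k)}\in\mathbb{R}^n$ are arbitrary distortions, let $\hat{\mathbf{d}}^{(k)}=\mathbf{A}\hat{\mathbf{y}}^{(k)}$, and set $\boldsymbol{\lambda}^{(k+1)}=\boldsymbol{\lambda}^{(k)}+\gamma_k\hat{\mathbf{d}}^{(k)}$, with stepsize $\gamma_k>0$. The distortions are bounded by constants: $\|\mathbf{r}_i^{(k)}\|\le\varepsilon_i$ for all $i$ and $k$, and $\epsilon:=\sqrt{\sum_{i=1}^{m-1}(\varepsilon_i+\varepsilon_{i+1})^2}$. Norms are Euclidean. A function $\varphi$ is strongly convex with constant $\sigma>0$ if $\varphi-\frac{\sigma}{2}\|\cdot\|^2$ is convex. *)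

(* Defs.v *)
From HB Require Import structures.
From mathcomp Require Export all_boot all_order all_algebra.
From mathcomp Require Export all_classical all_reals all_analysis.

Set Implicit Arguments.
Unset Strict Implicit.
Unset Printing Implicit Defensive.

Import Order.TTheory GRing.Theory Num.Theory.
Import numFieldNormedType.Exports.

Local Open Scope classical_set_scope.
Local Open Scope ring_scope.

(* A vector of (R^n)^m = R^(nm) is stored as an m x n matrix whose i-th row is
   its i-th block; likewise a multiplier of R^(n(m-1)) is an (m-1) x n matrix. *)

(* Euclidean structure; the library norm `|x| on matrices is the sup norm. *)
Definition edot (R : realType) (p q : nat) (x y : 'M[R]_(p, q)) : R :=
  \sum_(i < p) \sum_(j < q) x i j * y i j.

Definition enorm (R : realType) (p q : nat) (x : 'M[R]_(p, q)) : R :=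
  Num.sqrt (edot x x).

Definition closed_function (R : realType) (n : nat) (f : 'rV[R]_n -> R) : Prop :=
  closed [set z : 'rV[R]_n * R | f z.1 <= z.2].

Definition strictly_convex (R : realType) (n : nat) (f : 'rV[R]_n -> R) : Prop :=
  forall (x y : 'rV[R]_n) (t : R), x != y -> 0 < t -> t < 1 ->
    f (t *: x + (1 - t) *: y) < t * f x + (1 - t) * f y.

Definition strongly_convex (R : realType) (n : nat) (sigma : R)
    (f : 'rV[R]_n -> R) : Prop :=
  convex_function [set: 'rV[R]_n] (fun x => f x - sigma / 2 * enorm x ^+ 2).

Lemma ord_next_proof (m : nat) (i : 'I_m.-1) : (i.+1 < m)%N.
Proof. by case: m i => [|m] [i] //=. Qed.

(* Positions i and i+1 of 'I_m, for i in 'I_(m-1). *)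
Definition ord_here (m : nat) (i : 'I_m.-1) : 'I_m := widen_ord (leq_pred m) i.
Definition ord_next (m : nat) (i : 'I_m.-1) : 'I_m := Ordinal (ord_next_proof i).

Section ConsensusProblem.
Variables (R : realType) (m n : nat).
Variables (Y : set 'rV[R]_n) (f : 'I_m -> 'rV[R]_n -> R).
Implicit Types (y : 'M[R]_(m, n)) (lambda : 'M[R]_(m.-1, n)).

Definition objective y : R := \sum_(i < m) f i (row i y).

Definition Ybar : set 'M[R]_(m, n) := [set y | forall i, Y (row i y)].

Definition opA y : 'M[R]_(m.-1, n) :=
  \matrix_(i < m.-1) (row (ord_here i) y - row (ord_next i) y).

Definition lagrangian lambda y : R := objective y + edot lambda (opA y).

Definition dual_function lambda : \bar R :=
  ereal_inf [set (lagrangian lambda y)%:E | y in Ybar].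

Definition primal_optimal (ystar : 'M[R]_(m, n)) : Prop :=
  [/\ Ybar ystar, opA ystar = 0 &
      forall y, Ybar y -> opA y = 0 -> objective ystar <= objective y].

Definition dual_optimal (lambdastar : 'M[R]_(m.-1, n)) : Prop :=
  forall lambda, (dual_function lambda <= dual_function lambdastar)%E.

Definition lagrangian_argmin lambda y : Prop :=
  Ybar y /\ forall z, Ybar z -> lagrangian lambda y <= lagrangian lambda z.

(* Row i of [r k] is the distortion of the i-th block at iteration k. *)
Definition inexact_dual_algorithm (gamma : nat -> R) (r : nat -> 'M[R]_(m, n))
    (lambda : nat -> 'M[R]_(m.-1, n)) (y : nat -> 'M[R]_(m, n)) : Prop :=
  forall k, lagrangian_argmin (lambda k) (y k) /\
    lambda k.+1 = lambda k + gamma k *: opA (y k + r k).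

End ConsensusProblem.

(* With blocks stored as rows, (B \otimes I_n) y is the product B *m y. *)
Definition block_average (R : realType) (m n : nat) (y : 'M[R]_(m, n)) :
    'M[R]_(m, n) :=
  m%:R^-1 *: ((const_mx 1 : 'M[R]_m) *m y).

Definition total_distortion (R : realType) (m : nat) (eps : 'I_m -> R) : R :=
  Num.sqrt (\sum_(i < m.-1) (eps (ord_here i) + eps (ord_next i)) ^+ 2).

Definition is_min_of (R : realType) (m : nat) (mu : 'I_m -> R) (mumin : R) : Prop :=
  (exists i, mumin = mu i) /\ forall i, mumin <= mu i.

Definition Lh (R : realType) (m : nat) (mumin : R) : R :=
  mumin^-1 * (2 + 2 * cos (pi / m%:R)).

Definition running_min (R : realType) (u : nat -> R) (k : nat) : R :=
  \big[Num.min/u 0%N]_(i < k.+1) u i.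

Definition root4 (R : realType) (x : R) : R := x `^ 4^-1.

Definition rate (R : realType) (p : R) (k : nat) : R :=
  if p == 1 then (root4 (ln k%:R))^-1 else (root4 (k%:R `^ (1 - p)))^-1.

(* Main.v *)
Require Import Defs.
From HB Require Import structures.
From mathcomp Require Import all_boot all_order all_algebra.
From mathcomp Require Import all_classical all_reals all_analysis.
From mathcomp Require Import ring lra.

Set Implicit Arguments.
Unset Strict Implicit.
Unset Printing Implicit Defensive.

Import Order.TTheory GRing.Theory Num.Theory.
Import numFieldNormedType.Exports.

Local Open Scope classical_set_scope.
Local Open Scope ring_scope.

(** By strong duality [ystar] minimizes the Lagrangian at [lambdastar]. Adding the
    quadratic growth inequalities of the two Lagrangians at their minimizers
    [y k] and [ystar] gives, with modulus [s] and [E k = |y k - ystar| ^ 2],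
      [<lambda k - lambdastar, A (y k)> <= - s * E k],
    while [|A (y k)| ^ 2 <= (2 + 2 cos (pi / m)) * E k].
    For stepsizes at most [1 / Lh] the multiplier update then satisfies
      [|lambda k.+1 - lambdastar| ^ 2 <= |lambda k - lambdastar| ^ 2
         - s / 2 * gamma k * (E k - B)],  [B = 4 eps D / s + 3 eps ^ 2].
    Summing, the smallest [E i] with [i <= k] is at most
    [2 D ^ 2 / (s * sum gamma) + B], so [rho1 = sqrt B] works: averaging the blocks
    is nonexpansive and fixes [ystar]. The error decays like [1 / sqrt (sum gamma)],
    which is dominated by the claimed fourth-root rate. *)

(** * Euclidean structure on matrices *)

Section Euclidean.
Variables (R : realType) (p q : nat).
Implicit Types (x y z : 'M[R]_(p, q)) (a : R).

Lemma edotC x y : edot x y = edot y x.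
Proof. by apply: eq_bigr => i _; apply: eq_bigr => j _; rewrite mulrC. Qed.

Lemma edotDl x y z : edot (x + y) z = edot x z + edot y z.
Proof.
rewrite -big_split; apply: eq_bigr => i _; rewrite -big_split.
by apply: eq_bigr => j _; rewrite mxE mulrDl.
Qed.

Lemma edotZl a x y : edot (a *: x) y = a * edot x y.
Proof.
rewrite /edot mulr_sumr; apply: eq_bigr => i _; rewrite mulr_sumr.
by apply: eq_bigr => j _; rewrite mxE mulrA.
Qed.

Lemma edotNl x y : edot (- x) y = - edot x y.
Proof. by rewrite -scaleN1r edotZl mulN1r. Qed.

Lemma edotDr x y z : edot x (y + z) = edot x y + edot x z.
Proof. by rewrite edotC edotDl !(edotC x). Qed.

Lemma edotZr a x y : edot x (a *: y) = a * edot x y.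
Proof. by rewrite edotC edotZl edotC. Qed.

Lemma edotNr x y : edot x (- y) = - edot x y.
Proof. by rewrite edotC edotNl edotC. Qed.

Lemma edot0r x : edot x 0 = 0.
Proof. by rewrite -(scale0r 0) edotZr mul0r. Qed.

Definition edotE := (edotDl, edotDr, edotNl, edotNr, edotZl, edotZr).

Lemma edot_ge0 x : 0 <= edot x x.
Proof. by do 2![apply: sumr_ge0 => ? _]; rewrite -expr2 sqr_ge0. Qed.

Lemma enorm_ge0 x : 0 <= enorm x. Proof. exact: sqrtr_ge0. Qed.

Lemma enorm_sqr x : enorm x ^+ 2 = edot x x.
Proof. by rewrite sqr_sqrtr // edot_ge0. Qed.

(** Expand the nonnegative square of [a *: x - b *: y] with [a = enorm y] and [b = enorm x]. *)
Lemma edot_le_enormM x y : edot x y <= enorm x * enorm y.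
Proof.
have x0 := enorm_ge0 x; have y0 := enorm_ge0 y.
have quad a b : 0 <= a ^+ 2 * enorm x ^+ 2 - 2 * a * b * edot x y
    + b ^+ 2 * enorm y ^+ 2.
  rewrite !enorm_sqr.
  rewrite [leRHS](_ : _ = edot (a *: x - b *: y) (a *: x - b *: y)) ?edot_ge0 //.
  by rewrite !edotE (edotC y x); ring.
have [xy0|xy0] := eqVneq (enorm x * enorm y) 0; last first.
  have := quad (enorm y) (enorm x).
  have : 0 < enorm x * enorm y by rewrite lt_def xy0 mulr_ge0.
  nra.
(* Degenerate case: if one norm vanished while [edot x y] is positive, giving that vector the weight
   1 plus the other squared norm, and the other vector the weight [edot x y], would make the square
   negative. *)
rewrite xy0; apply: contra_eqT xy0; rewrite -ltNge => xy_gt0.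
rewrite mulf_neq0 //; apply/eqP => z0.
  have := quad (1 + enorm y ^+ 2) (edot x y); rewrite z0.
  have := mulr_ge0 (sqr_ge0 (edot x y)) (sqr_ge0 (enorm y)).
  have : 0 < edot x y ^+ 2 by rewrite exprn_gt0.
  lra.
have := quad (edot x y) (1 + enorm x ^+ 2); rewrite z0.
have := mulr_ge0 (sqr_ge0 (edot x y)) (sqr_ge0 (enorm x)).
have : 0 < edot x y ^+ 2 by rewrite exprn_gt0.
lra.
Qed.

Lemma enormD x y : enorm (x + y) <= enorm x + enorm y.
Proof.
have xy0 : 0 <= enorm x + enorm y by rewrite addr_ge0 ?enorm_ge0.
rewrite -(ler_pXn2r (n := 2)) ?nnegrE ?enorm_ge0 //.
rewrite enorm_sqr !edotE (edotC y x) sqrrD !enorm_sqr.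
have := edot_le_enormM x y; lra.
Qed.

Lemma enormN x : enorm (- x) = enorm x.
Proof. by rewrite /enorm !edotE opprK. Qed.

End Euclidean.

Lemma enorm_sqr_rows (R : realType) (p q : nat) (x : 'M[R]_(p, q)) :
  enorm x ^+ 2 = \sum_(i < p) enorm (row i x) ^+ 2.
Proof.
rewrite enorm_sqr; apply: eq_bigr => i _.
rewrite enorm_sqr /edot big_ord1; apply: eq_bigr => j _.
by rewrite mxE.
Qed.

(** * The difference operator *)

Section DifferenceOperator.
Variables (R : realType) (m n : nat).
Implicit Types y z : 'M[R]_(m, n).

Lemma opAE y i j : opA y i j = y (ord_here i) j - y (ord_next i) j.
Proof. by rewrite !mxE. Qed.

Lemma opAD y z : opA (y + z) = opA y + opA z.
Proof. by apply/matrixP => i j; rewrite [RHS]mxE !opAE !mxE; ring. Qed.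

Lemma opAZ a y : opA (a *: y) = a *: opA y.
Proof. by apply/matrixP => i j; rewrite [RHS]mxE !opAE !mxE; ring. Qed.

Lemma opAB y z : opA (y - z) = opA y - opA z.
Proof. by rewrite -scaleN1r opAD opAZ scaleN1r. Qed.

Lemma row_opA y i : row i (opA y) = row (ord_here i) y - row (ord_next i) y.
Proof. by apply/matrixP => k j; rewrite !mxE. Qed.

(** Applied to [r k], this turns the blockwise bounds into the form in which distortions enter the
    multiplier update. *)
Lemma enorm_opA_le_total_distortion (eps : 'I_m -> R) y :
  (forall i, enorm (row i y) <= eps i) ->
  enorm (opA y) <= total_distortion eps.
Proof.
move=> yeps; rewrite -[leLHS]ger0_norm ?enorm_ge0 // -sqrtr_sqr.
rewrite enorm_sqr_rows ler_wsqrtr //; apply: ler_sum => i _.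
rewrite ler_sqr ?nnegrE ?enorm_ge0 //; last first.
  by rewrite addr_ge0 // (le_trans (enorm_ge0 _) (yeps _)).
rewrite row_opA (le_trans (enormD _ _)) // enormN lerD //.
Qed.

End DifferenceOperator.

Lemma opA_eq0_row (R : realType) (m n : nat) (y : 'M[R]_(m, n)) i i' :
  opA y = 0 -> row i y = row i' y.
Proof.
case: m i i' y => [[//]|m'] i i' y Ay0; apply/rowP => j; rewrite !mxE.
suff y0 k : y k j = y ord0 j by rewrite (y0 i) (y0 i').
case: k => k; elim: k => [|k IHk] km; first by congr (y _ _); apply: val_inj.
rewrite -(IHk (ltnW km)); apply/esym/eqP; rewrite -subr_eq0.
have : opA y (Ordinal (km : (k < m'.+1.-1)%N)) j = 0 by rewrite Ay0 mxE.
rewrite opAE => <-; apply/eqP; congr (y _ _ - y _ _); exact: val_inj.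
Qed.

Section DifferenceNorm.
Variable R : realType.

(* In the proof, the weights [s] are the components (up to sign) of the top eigenvector of
   the Laplacian of the path on [m.+1] vertices, vertex [k] having weight
   [s k.+1]. *)
Lemma sum_sqr_diff_le (m : nat) (x : nat -> R) :
  \sum_(i < m) (x i - x i.+1) ^+ 2 <=
  (2 + 2 * cos (pi / m.+1%:R)) * \sum_(i < m.+1) x i ^+ 2.
Proof.
set t : R := pi / m.+1%:R; set c := cos t.
have mt : t * m.+1%:R = pi by rewrite divfK // pnatr_eq0.
have t0 : 0 < t by rewrite divr_gt0 ?pi_gt0 // ltr0n.
pose s k : R := sin ((k%:R - 2^-1) * t).
(* Eigenvector equation, from sin (u + t) + sin (u - t) = 2 cos t sin u. *)
have sS k : s k.+2 = 2 * c * s k.+1 - s k.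
  rewrite /s; set u := (k.+1%:R - 2^-1) * t.
  have -> : (k.+2%:R - 2^-1) * t = u + t by rewrite /u -natr1; ring.
  have -> : (k%:R - 2^-1) * t = u - t by rewrite /u -[k.+1%:R]natr1; ring.
  by rewrite sinD sinB; rewrite -/c; ring.
have s_gt0 k : (k <= m)%N -> 0 < s k.+1.
  move=> km; apply: sin_gt0_pi; rewrite -mt [t * _]mulrC ltr_pM2r //.
  have k1 : 1 <= k.+1%:R :> R by rewrite ler1n.
  have km1 : k.+1%:R <= m.+1%:R :> R by rewrite ler_nat.
  by apply/andP; split; [apply: mulr_gt0 => //|]; lra.
(* The half-integer shift makes [s] odd about both ends of the path, which gives the boundary
   conditions. *)
have s0 : s 0%N = - s 1%N.
  by rewrite /s -sinN; congr (sin _); lra.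
have sm : s m.+2 = - s m.+1.
  have -> : s m.+2 = sin (t / 2 + pi).
    by rewrite /s -mt -natr1; congr sin; field.
  have -> : s m.+1 = sin (- (t / 2) + pi).
    by rewrite /s -mt; congr sin; field.
  by rewrite !sinDpi sinN !opprK.
pose w k := s k / s k.+1.
have wS k : (k <= m)%N -> w k + s k.+2 / s k.+1 = 2 * c.
  move=> km; rewrite /w sS; field; exact: lt0r_neq0 (s_gt0 _ km).
(* Weighted Young inequality: the gap between the sides is a square over a positive product. *)
have young k : (k < m)%N -> (x k - x k.+1) ^+ 2 <=
    (1 + s k.+2 / s k.+1) * x k ^+ 2 + (1 + w k.+1) * x k.+1 ^+ 2.
  move=> km; have p0 := s_gt0 _ (ltnW km); have p1 := s_gt0 _ km.
  rewrite /w -subr_ge0.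
  rewrite [leRHS](_ : _ = (s k.+2 * x k + s k.+1 * x k.+1) ^+ 2
      / (s k.+1 * s k.+2)); last by field; rewrite !lt0r_neq0.
  by rewrite divr_ge0 ?sqr_ge0 // mulr_ge0 ?ltW.
(* In the sum, each interior index collects [2 + 2 * c] by [wS]. The left end starts from
   [1 + w 0 = 0]; at the right end [s m.+2 / s m.+1 = -1] turns [1 + w m] into [2 + 2 * c]. *)
have part k : (k <= m)%N -> \sum_(i < k) (x i - x i.+1) ^+ 2 <=
    (2 + 2 * c) * \sum_(i < k) x i ^+ 2 + (1 + w k) * x k ^+ 2.
  elim: k => [|k IHk] km.
    rewrite !big_ord0 /w s0 mulNr divff ?lt0r_neq0 ?s_gt0 //.
    by rewrite subrr mul0r mulr0 addr0.
  rewrite !big_ord_recr /=; have := IHk (ltnW km); have := young _ km.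
  have := wS _ (ltnW km); nra.
apply: le_trans (part m (leqnn m)) _; rewrite [in leRHS]big_ord_recr /= mulrDr.
have := wS _ (leqnn m); rewrite sm mulNr divff ?lt0r_neq0 ?s_gt0 //.
have := sqr_ge0 (x m); nra.
Qed.

(** The operator acts on each column separately, so the scalar bound applies columnwise; [inord]
    extends a column to a sequence on [nat]. *)
Lemma enorm_opA_le (m n : nat) (y : 'M[R]_(m, n)) : (0 < m)%N ->
  enorm (opA y) ^+ 2 <= (2 + 2 * cos (pi / m%:R)) * enorm y ^+ 2.
Proof.
case: m y => // m y _; rewrite !enorm_sqr /edot exchange_big /=.
rewrite [in leRHS]exchange_big mulr_sumr /=; apply: ler_sum => j _.
have yE (i : 'I_m.+1) : y i j = y (inord i) j by rewrite inord_val.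
apply: le_trans (le_trans (sum_sqr_diff_le m (fun k => y (inord k) j)) _).
  by apply: ler_sum => i _; rewrite (opAE y i j) expr2 (yE (ord_here (i : 'I_m.+1.-1))) (yE (ord_next _)).
by rewrite le_eqVlt; apply/orP; left; apply/eqP; congr (_ * _);
  apply: eq_bigr => i _; rewrite expr2 -yE.
Qed.

End DifferenceNorm.

(** * Averaging the blocks *)

Lemma sum_sqr_mean_le (R : realType) (m : nat) (x : 'I_m -> R) (c : R) :
  \sum_(i < m) (m%:R^-1 * (\sum_k x k) - c) ^+ 2 <= \sum_(i < m) (x i - c) ^+ 2.
Proof.
case: m x => [|m] x; first by rewrite !big_ord0.
set a := m.+1%:R^-1 * _.
(* Deviations from the mean sum to zero, which kills the cross term when squares are recentred at
   [c]. *)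
have xa : \sum_i (x i - a) = 0.
  by rewrite sumrB sumr_const card_ord -mulr_natl mulVKf ?subrr ?pnatr_eq0.
have -> : \sum_i (x i - c) ^+ 2 =
    \sum_i (x i - a) ^+ 2 + \sum_(i < m.+1) (a - c) ^+ 2.
  transitivity (\sum_i (x i - a) ^+ 2 + \sum_(i < m.+1) (a - c) ^+ 2
    + 2 * (a - c) * \sum_i (x i - a)); last by rewrite xa mulr0 addr0.
  rewrite mulr_sumr -!big_split /=.
  by apply: eq_bigr => i _; ring.
by rewrite lerDr; apply: sumr_ge0 => i _; rewrite sqr_ge0.
Qed.

(** A feasible [ystar] has constant columns, and averaging a column brings it no farther from a
    constant one. *)
Lemma enorm_block_average_le (R : realType) (m n : nat)
    (y ystar : 'M[R]_(m, n)) :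
  opA ystar = 0 -> enorm (block_average y - ystar) <= enorm (y - ystar).
Proof.
move=> Ay0; rewrite ler_wsqrtr // /edot exchange_big [leRHS]exchange_big /=.
apply: ler_sum => j _; case: m y ystar Ay0 => [|m] y ystar Ay0.
  by rewrite !big_ord0.
have yE i : ystar i j = ystar ord0 j.
  by have /rowP/(_ j) := opA_eq0_row i ord0 Ay0; rewrite !mxE.
apply: le_trans (le_trans (sum_sqr_mean_le (y ^~ j) (ystar ord0 j)) _);
  apply: ler_sum => i _; rewrite -expr2 !mxE yE //.
by under eq_bigr do rewrite mxE mul1r.
Qed.

(** * Strong convexity of the objective and the saddle point *)

Definition sconvex (R : realType) (p q : nat) (s : R) (F : 'M[R]_(p, q) -> R) :=
  forall (x y : 'M[R]_(p, q)) (t : R), 0 < t < 1 ->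
    F (t *: x + (1 - t) *: y) <=
    t * F x + (1 - t) * F y - s / 2 * (t * (1 - t)) * enorm (x - y) ^+ 2.

(** The quadratic term is the defect of the squared norm: t|x|^2 + (1-t)|y|^2 - |tx + (1-t)y|^2 =
    t(1-t)|x - y|^2. *)
Lemma strongly_convex_sconvex (R : realType) (n : nat) (s : R)
    (f : 'rV[R]_n -> R) : strongly_convex s f -> sconvex s f.
Proof.
move=> sf x y t /andP[t0 t1].
have : f (t *: x + (1 - t) *: y)
      - s / 2 * enorm (t *: x + (1 - t) *: y) ^+ 2 <=
    t * (f x - s / 2 * enorm x ^+ 2) + (1 - t) * (f y - s / 2 * enorm y ^+ 2) :=
  sf (Itv01 (ltW t0) (ltW t1)) x y (in_setT _) (in_setT _).
rewrite !enorm_sqr !edotE (edotC y x).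
lra.
Qed.

Section SaddlePoint.
Variables (R : realType) (m n : nat).
Variables (Y : set 'rV[R]_n) (f : 'I_m -> 'rV[R]_n -> R).
Implicit Types (y z : 'M[R]_(m, n)) (lambda : 'M[R]_(m.-1, n)).

Lemma row_lincomb a b y z i :
  row i (a *: y + b *: z) = a *: row i y + b *: row i z.
Proof. by apply/rowP => j; rewrite !mxE. Qed.

Lemma objective_sconvex (mu : 'I_m -> R) (s : R) :
  (forall i, strongly_convex (mu i) (f i)) -> (forall i, s <= mu i) ->
  sconvex s (objective f).
Proof.
move=> fmu smu x y t t01; rewrite enorm_sqr_rows !mulr_sumr -big_split -sumrB /=.
apply: ler_sum => i _; rewrite row_lincomb.
have -> : row i (x - y) = row i x - row i y by apply/rowP => j; rewrite !mxE.
apply: le_trans (strongly_convex_sconvex (fmu i) _ _ t01) _.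
rewrite lerD2l lerN2 !ler_wpM2r ?sqr_ge0 ?invr_ge0 //.
by case/andP: t01 => t0 t1; rewrite mulr_ge0 ?subr_ge0 // ltW.
Qed.

Lemma Ybar_convex y z t : convex_set Y -> 0 <= t <= 1 ->
  Ybar Y y -> Ybar Y z -> Ybar Y (t *: y + (1 - t) *: z).
Proof.
move=> Yconvex /andP[t0 t1] yY zY i; rewrite row_lincomb.
have := Yconvex _ _ (Itv01 t0 t1) (mem_set (yY i)) (mem_set (zY i)).
by rewrite inE.
Qed.

(** Compare the minimizer [y] with [t *: z + (1 - t) *: y], divide by [t] and let [t] tend to 0; the
    multiplier term is linear and leaves the modulus unchanged. *)
Lemma lagrangian_argmin_growth (s : R) lambda y z : 0 <= s -> convex_set Y ->
  sconvex s (objective f) -> lagrangian_argmin Y f lambda y -> Ybar Y z ->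
  lagrangian f lambda y + s / 2 * enorm (z - y) ^+ 2 <= lagrangian f lambda z.
Proof.
move=> s0 Yconvex fs [yY ymin] zY; set E := s / 2 * _.
have E0 : 0 <= E by rewrite mulr_ge0 ?divr_ge0 ?sqr_ge0.
suff bound t : 0 < t < 1 -> (1 - t) * E <= lagrangian f lambda z - lagrangian f lambda y.
  (* This [t] lies strictly between 0 and 1 and satisfies [t * E <= e]. *)
  apply/ler_addgt0Pr => e e0; pose t := e / (1 + e + E).
  have d0 : 0 < 1 + e + E by lra.
  have tE : t * (1 + e + E) = e by rewrite divfK ?lt0r_neq0.
  have t0 : 0 < t by rewrite divr_gt0.
  have t1 : t < 1 by rewrite ltr_pdivrMr //; lra.
  have := bound t; rewrite t0 t1 => /(_ isT); nra.
move=> t01; have /andP[t0 t1] := t01.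
have t01' : 0 <= t <= 1 by rewrite !ltW.
have := ymin _ (Ybar_convex Yconvex t01' zY yY).
have := fs z y t t01; rewrite /lagrangian opAD !opAZ !edotE => h1 h2.
rewrite -(ler_pM2l t0) /E; move: h1 h2; lra.
Qed.

Lemma strong_duality_argmin ystar lambdastar : primal_optimal Y f ystar ->
  (objective f ystar)%:E = dual_function Y f lambdastar ->
  lagrangian_argmin Y f lambdastar ystar.
Proof.
move=> [yY Ay0 _] dual; split=> // z zY.
rewrite /lagrangian Ay0 edot0r addr0 -lee_fin dual.
by apply: ereal_inf_lbound; exists z.
Qed.

Lemma argmin_monotone (s : R) lambda lambda' y y' : 0 <= s -> convex_set Y ->
  sconvex s (objective f) ->
  lagrangian_argmin Y f lambda y -> lagrangian_argmin Y f lambda' y' ->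
  edot (lambda - lambda') (opA (y - y')) <= - (s * enorm (y - y') ^+ 2).
Proof.
move=> s0 Yconvex fs ymin y'min; have [[yY _] [y'Y _]] := (ymin, y'min).
have := lagrangian_argmin_growth s0 Yconvex fs ymin y'Y.
have := lagrangian_argmin_growth s0 Yconvex fs y'min yY.
rewrite -[y' - y]opprB enormN /lagrangian opAB !edotE; lra.
Qed.

End SaddlePoint.

(** * Descent estimate *)

Section Descent.
Variables (R : realType) (m n : nat).
Variables (Y : set 'rV[R]_n) (f : 'I_m -> 'rV[R]_n -> R).
Variables (s D e : R) (ystar : 'M[R]_(m, n)) (lambdastar : 'M[R]_(m.-1, n)).
Variables (gamma : nat -> R) (r : nat -> 'M[R]_(m, n)).
Variables (lambda : nat -> 'M[R]_(m.-1, n)) (y : nat -> 'M[R]_(m, n)).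
Hypotheses (m_ge2 : (2 <= m)%N) (Yconvex : convex_set Y) (s_gt0 : 0 < s).
Hypothesis fs : sconvex s (objective f).
Hypothesis ystar_min : lagrangian_argmin Y f lambdastar ystar.
Hypothesis opA_ystar : opA ystar = 0.
Hypothesis algo : inexact_dual_algorithm Y f gamma r lambda y.
Hypothesis r_le : forall k, enorm (opA (r k)) <= e.
Hypothesis gamma_gt0 : forall k, 0 < gamma k.
Hypothesis gamma_le : forall k, gamma k * (2 + 2 * cos (pi / m%:R)) <= s.
Hypothesis lambda_le : forall k, enorm (lambda k - lambdastar) <= D.

Let E k := enorm (y k - ystar) ^+ 2.
Let B := 4 * e * D / s + 3 * e ^+ 2.

(** It yields [2 * gamma k <= s], which controls the quadratic distortion term. *)
Lemma cos_pi_div_ge0 : 0 <= cos (pi / m%:R : R).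
Proof.
apply: cos_ge0_pihalf; have pi0 : 0 < pi :> R := pi_gt0 R.
have m2 : 2 <= m%:R :> R by rewrite ler_nat.
apply/andP; split.
  by rewrite (@le_trans _ _ 0) ?oppr_le0 ?divr_ge0 // ?ltW.
by rewrite ler_pM2l // lef_pV2 // posrE; lra.
Qed.

Lemma multiplier_descent k :
  s / 2 * gamma k * (E k - B) <=
  enorm (lambda k - lambdastar) ^+ 2 - enorm (lambda k.+1 - lambdastar) ^+ 2.
Proof.
have [ymin ->] := algo k; set v := lambda k - lambdastar.
have -> : lambda k + gamma k *: opA (y k + r k) - lambdastar =
  v + gamma k *: (opA (y k) + opA (r k)) by rewrite opAD addrAC.
set d := opA (y k); set q := opA (r k); set g := gamma k.
have g0 : 0 < g := gamma_gt0 k.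
have dE : d = opA (y k - ystar) by rewrite opAB opA_ystar subr0.
have vd : edot v d <= - (s * E k).
  by rewrite dE; exact: argmin_monotone (ltW s_gt0) Yconvex fs ymin ystar_min.
have e0 : 0 <= e := le_trans (enorm_ge0 _) (r_le k).
have D0 : 0 <= D := le_trans (enorm_ge0 _) (lambda_le k).
have vq : edot v q <= e * D.
  apply: le_trans (edot_le_enormM v q) _.
  by rewrite mulrC ler_pM ?enorm_ge0 ?r_le ?lambda_le.
have qq : edot q q <= e ^+ 2.
  by rewrite -enorm_sqr ler_sqr ?nnegrE ?enorm_ge0 ?r_le.
have dd : edot d d <= (2 + 2 * cos (pi / m%:R)) * E k.
  by rewrite -enorm_sqr dE enorm_opA_le // ltnW.
(* These weights give |d + q|^2 <= (3/2)|d|^2 + 3|q|^2: the first part consumes three quarters of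
   the decrease [2 * s * E k] and the second produces the [3 * e ^+ 2] in [B]. *)
have dq : 2 * edot d q <= edot d d / 2 + 2 * edot q q.
  by have := edot_ge0 (d - 2 *: q); rewrite !edotE (edotC q d); lra.
have gdd : g * edot d d <= s * E k.
  apply: le_trans (ler_wpM2l (ltW g0) dd) _.
  by rewrite mulrA ler_wpM2r ?sqr_ge0 // gamma_le.
have gqq : g * edot q q <= s / 2 * e ^+ 2.
  apply: ler_pM; rewrite ?edot_ge0 ?(ltW g0) //.
  have := gamma_le k; have := cos_pi_div_ge0; rewrite -/g => c0.
  have := mulr_ge0 (ltW g0) c0; lra.
have sB : s * B = 4 * e * D + 3 * s * e ^+ 2.
  by rewrite /B; field; rewrite lt0r_neq0.
rewrite !enorm_sqr; clear dE; clearbody v.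
rewrite !edotE (edotC d v) (edotC q v) (edotC q d).
have -> : s / 2 * g * (E k - B) = g * (s * E k - s * B) / 2 by ring.
rewrite sB.
have key : s * E k - (4 * e * D + 3 * s * e ^+ 2) <=
  - (4 * (edot v d + edot v q) + 2 * g * (edot d d + 2 * edot d q + edot q q)).
  have := ler_wpM2l (ltW g0) dq; lra.
have := ler_wpM2l (ltW g0) key; lra.
Qed.

Lemma running_min_le (u : nat -> R) k i : (i <= k)%N -> running_min u k <= u i.
Proof.
by move=> ik; exact: (bigmin_le (u 0%N) (Ordinal (ik : (i < k.+1)%N)) (u \o _)).
Qed.

Lemma running_min_ge0 (u : nat -> R) k : (forall i, 0 <= u i) ->
  0 <= running_min u k.
Proof. by move=> u0; apply: le_bigmin. Qed.

(** Since [M ^+ 2 <= E i] for all [i <= k], the descent estimates hold with [M ^+ 2] in place of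
    [E i]; they then telescope, and the final squared distance is dropped. *)
Lemma running_min_sqr_le k :
  running_min (fun k => enorm (block_average (y k) - ystar)) k ^+ 2 <=
  2 * D ^+ 2 / s / series gamma k.+1 + B.
Proof.
set M := running_min _ k.
have M0 : 0 <= M by apply: running_min_ge0 => i; exact: enorm_ge0.
have ME i : (i < k.+1)%N -> M ^+ 2 <= E i.
  move=> ik; rewrite ler_sqr ?nnegrE ?enorm_ge0 //.
  apply: le_trans (enorm_block_average_le (y i) opA_ystar).
  exact: (running_min_le (fun k => enorm (block_average (y k) - ystar))).
have sum_le j : (j <= k.+1)%N -> s / 2 * (series gamma j * (M ^+ 2 - B)) <=
    enorm (lambda 0%N - lambdastar) ^+ 2 - enorm (lambda j - lambdastar) ^+ 2.
  elim: j => [|j IHj] jk; first by rewrite /series /= big_geq // mul0r mulr0 subrr.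
  rewrite seriesSr mulrDl mulrDr.
  have := IHj (ltnW jk); have := multiplier_descent j.
  have : s / 2 * (gamma j * (M ^+ 2 - B)) <= s / 2 * gamma j * (E j - B).
    rewrite mulrA ler_wpM2l ?lerD2r ?ME //.
    by rewrite mulr_ge0 ?divr_ge0 ?(ltW s_gt0) ?(ltW (gamma_gt0 _)).
  lra.
have S0 : 0 < series gamma k.+1.
  rewrite seriesSr ltr_wpDl ?gamma_gt0 // /series /= sumr_ge0 // => i _.
  exact: ltW (gamma_gt0 i).
have D0 : 0 <= D := le_trans (enorm_ge0 _) (lambda_le 0).
have lD : enorm (lambda 0%N - lambdastar) ^+ 2 <= D ^+ 2.
  by rewrite ler_sqr ?nnegrE ?enorm_ge0 ?lambda_le.
rewrite -lerBlDr ler_pdivlMr // ler_pdivlMr //.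
have := sum_le _ (leqnn _); have := sqr_ge0 (enorm (lambda k.+1 - lambdastar)).
lra.
Qed.

(** Squaring the right-hand side adds only a nonnegative cross term. *)
Lemma running_min_le_sqrt k :
  running_min (fun k => enorm (block_average (y k) - ystar)) k <=
  Num.sqrt (2 * D ^+ 2 / s) / Num.sqrt (series gamma k.+1) + Num.sqrt B.
Proof.
have S0 : 0 <= series gamma k.+1.
  by rewrite /series /= sumr_ge0 // => i _; exact: ltW (gamma_gt0 i).
set a := Num.sqrt _; set b := Num.sqrt _; set c := Num.sqrt B.
have ab0 : 0 <= a / b by rewrite divr_ge0 ?sqrtr_ge0.
have c0 : 0 <= c := sqrtr_ge0 _.
have D0 : 0 <= D := le_trans (enorm_ge0 _) (lambda_le 0).
have e0 : 0 <= e := le_trans (enorm_ge0 _) (r_le 0).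
have B0 : 0 <= B.
  by rewrite addr_ge0 ?mulr_ge0 ?sqr_ge0 ?invr_ge0 ?(ltW s_gt0).
have DD : 0 <= 2 * D ^+ 2 / s.
  by rewrite !mulr_ge0 ?sqr_ge0 ?invr_ge0 ?(ltW s_gt0).
rewrite -(ler_pXn2r (n := 2)) ?nnegrE ?addr_ge0 //; last first.
  by apply: running_min_ge0 => i; exact: enorm_ge0.
apply: le_trans (running_min_sqr_le k) _.
rewrite sqrrD expr_div_n !sqr_sqrtr //.
by rewrite lerD2r lerDl mulrn_wge0 // mulr_ge0.
Qed.

End Descent.

(** * Growth of the partial sums of the stepsizes *)

Section Rates.
Variable R : realType.
Implicit Types (p x c : R) (k : nat).

(** For [p] in [0, 1], the order of growth of the partial sums of the stepsizes. *)
Definition stepsum p k : R := if p == 1 then ln k%:R else k%:R `^ (1 - p).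

Lemma rateE p k : rate p k = (root4 (stepsum p k))^-1.
Proof. by rewrite /rate /stepsum; case: ifP. Qed.

Lemma stepsum_ge1 p : 0 <= p <= 1 -> \forall k \near \oo, 1 <= stepsum p k.
Proof.
case/andP=> p0 p1; near=> k; rewrite /stepsum; case: eqVneq => [_|pN1].
  have k_ge : expR 1 <= k%:R :> R by near: k; exact: nbhs_infty_ger.
  rewrite -[leLHS](expRK (1 : R)) ler_ln ?posrE ?expR_gt0 //.
  exact: lt_le_trans (expR_gt0 1) k_ge.
have k1 : 1 <= k%:R :> R by near: k; exact: nbhs_infty_ger.
by rewrite -[leLHS](powRr0 k%:R) ler_powR // subr_ge0.
Unshelve. all: by end_near. Qed.

(** For [p = 1], telescope ln (1 + 1/(j+1)) <= 1/(j+1). For [p < 1], each of the [k.+1] terms is at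
    least the last one. *)
Lemma stepsum_le_series p k : 0 <= p <= 1 -> (0 < k)%N ->
  stepsum p k <= series (fun i => (i.+1%:R `^ p)^-1) k.+1.
Proof.
case/andP=> p0 p1 k0; rewrite /stepsum; case: eqVneq => [->|pN1].
  apply: (@le_trans _ _ (ln k.+2%:R)).
    by rewrite ler_ln ?posrE ?ltr0n // ler_nat leqW.
  elim: (k.+1) => [|j IHj]; first by rewrite ln1 /series /= big_geq.
  have j0 : 0 < j.+1%:R :> R by rewrite ltr0n.
  have -> : j.+2%:R = j.+1%:R * (1 + j.+1%:R^-1) :> R.
    by rewrite mulrDr divff ?lt0r_neq0 // mulr1 natr1.
  rewrite seriesSr lnM ?posrE ?addr_gt0 ?invr_gt0 // lerD //.
  by rewrite powRr1 ?(ltW j0) // le_ln1Dx // (@lt_trans _ _ 0) ?invr_gt0 // oppr_lt0.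
have k10 : 0 < k.+1%:R :> R by rewrite ltr0n.
apply: (@le_trans _ _ (k.+1%:R `^ (1 - p))).
  by rewrite ge0_ler_powR ?nnegrE ?subr_ge0 // ler_nat.
rewrite powRB ?lt0r_neq0 ?implybT // powRr1 ?(ltW k10) // /series /= big_mkord.
rewrite [leLHS](_ : _ = \sum_(i < k.+1) (k.+1%:R `^ p)^-1); last first.
  by rewrite sumr_const card_ord mulr_natl.
apply: ler_sum => i _; rewrite lef_pV2 ?posrE ?powR_gt0 ?ltr0n //.
by apply: ge0_ler_powR; rewrite ?nnegrE // ler_nat.
Qed.

Lemma stepsum_sublinear p c : 0 < p <= 1 -> 0 < c ->
  \forall k \near \oo, stepsum p k <= c * k%:R.
Proof.
case/andP=> p0 p1 c0; near=> k.
have k0 : 0 < k%:R :> R.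
  by rewrite (@lt_le_trans _ _ 1) //; near: k; exact: nbhs_infty_ger.
rewrite /stepsum; case: eqVneq => [_|pN1]; last first.
  have kc : c^-1 `^ p^-1 <= k%:R by near: k; exact: nbhs_infty_ger.
  have ckp : c^-1 <= k%:R `^ p.
    have := ge0_ler_powR (ltW p0) _ _ kc.
    rewrite -powRrM mulVf ?lt0r_neq0 // powRr1 ?invr_ge0 ?(ltW c0) //.
    by apply; rewrite nnegrE ?powR_ge0 ?(ltW k0).
  rewrite powRB ?lt0r_neq0 ?implybT // powRr1 ?(ltW k0) // mulrC.
  rewrite ler_pM2r // -[leRHS]invrK lef_pV2 ?posrE ?invr_gt0 //.
  by rewrite powR_gt0.
(* Here ln k = 2 ln (sqrt k) <= 2 sqrt k, and sqrt k >= 2 / c suffices. *)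
have ck : (2 / c) ^+ 2 <= k%:R by near: k; exact: nbhs_infty_ger.
have sk0 : 0 < Num.sqrt k%:R :> R by rewrite sqrtr_gt0.
have sk : 2 <= c * Num.sqrt k%:R :> R.
  rewrite mulrC -ler_pdivrMr // -[leLHS]ger0_norm ?divr_ge0 ?(ltW c0) //.
  by rewrite -sqrtr_sqr ler_wsqrtr.
rewrite -(sqr_sqrtr (ltW k0)) lnXn // -[leLHS]mulr_natl.
apply: (@le_trans _ _ (2 * Num.sqrt k%:R)).
  by rewrite ler_pM2l // ltW // ln_sublinear.
by rewrite expr2 mulrA ler_pM2r.
Unshelve. all: by end_near. Qed.

Lemma root4_gt0 x : 0 < x -> 0 < root4 x.
Proof. exact: powR_gt0. Qed.

Lemma le_root4 x y : 0 <= x -> x <= y -> root4 x <= root4 y.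
Proof.
move=> x0 xy; rewrite ge0_ler_powR ?invr_ge0 ?nnegrE //; exact: le_trans xy.
Qed.

(** This relaxes the inverse square-root decay to the stated fourth-root rate. *)
Lemma root4_le_sqrt x : 1 <= x -> root4 x <= Num.sqrt x.
Proof.
move=> x1; rewrite -powR12_sqrt ?(le_trans ler01 x1) // ler_powR //; lra.
Qed.

Lemma rate0 k : rate 0 k = (root4 k%:R)^-1 :> R.
Proof. by rewrite rateE /stepsum eq_sym oner_eq0 subr0 powRr1. Qed.

(** Writing [e] as the fourth root of [e ^+ 4] reduces the comparison to
    [stepsum p k <= e ^+ 4 * k%:R]. *)
Lemma rate0_littleo p : 0 < p <= 1 ->
  (fun k : nat => ((root4 k%:R)^-1)%R : R) =o_\oo (fun k : nat => rate p k).
Proof.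
move=> p01; have /andP[p0 p1] := p01; apply/eqoP => e e0.
have e40 : 0 < e ^+ 4 by rewrite exprn_gt0.
have root4_e : root4 (e ^+ 4) = e.
  by rewrite /root4 -powR_mulrn ?(ltW e0) // -powRrM mulfV ?powRr1 ?(ltW e0) // pnatr_eq0.
have p01' : 0 <= p <= 1 by rewrite (ltW p0).
near=> k.
have k0 : 0 < k%:R :> R.
  by rewrite (@lt_le_trans _ _ 1) //; near: k; exact: nbhs_infty_ger.
have s1 : 1 <= stepsum p k by near: k; exact: stepsum_ge1.
have s0 : 0 < stepsum p k by exact: lt_le_trans ltr01 s1.
rewrite rateE !ger0_norm ?invr_ge0 ?powR_ge0 // ler_pdivlMr ?root4_gt0 //.
rewrite mulrC ler_pdivrMr ?root4_gt0 // -[X in _ <= X * _]root4_e.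
rewrite /root4 -powRM ?(ltW k0) ?(ltW e40) //; apply: le_root4; first exact: ltW.
by near: k; exact: stepsum_sublinear.
Unshelve. all: by end_near. Qed.

(** The limit superior is an infimum of suprema, so the supremum over one tail bounds it. *)
Lemma limn_esup_le (u : nat -> R) b :
  (forall e, 0 < e -> \forall k \near \oo, u k <= b + e) ->
  (limn_esup (fun k => (u k)%:E) <= b%:E)%E.
Proof.
move=> ub; apply/lee_addgt0Pr => e e0; have [N _ uN] := ub e e0.
apply: (@le_trans _ _ (ereal_sup [set (u k)%:E | k in [set k | (N <= k)%N]])).
  by apply: ereal_inf_lbound; exists [set k | (N <= k)%N] => //; exists N.
apply: ge_ereal_sup => _ [k Nk <-]; rewrite -EFinD lee_fin; exact: uN.
Qed.

Lemma div_sqrt_cvg0 (a : R) (S : nat -> R) : 0 <= a -> S @ \oo --> +oo ->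
  forall e, 0 < e -> \forall k \near \oo, a / Num.sqrt (S k.+1) <= e.
Proof.
(* The extra 1 keeps [S k.+1] positive even when [a = 0]. *)
move=> a0 /cvgryPge Soo e e0; have [N _ SN] := Soo ((a / e) ^+ 2 + 1).
exists N => // k /= Nk; have := SN k.+1 (leqW Nk).
move=> Sk; have S0 : 0 < S k.+1 by have := sqr_ge0 (a / e); lra.
rewrite ler_pdivrMr ?sqrtr_gt0 // mulrC -ler_pdivrMr //.
rewrite -[leLHS]ger0_norm ?divr_ge0 ?(ltW e0) // -sqrtr_sqr ler_wsqrtr //.
lra.
Qed.

End Rates.

(** * Convergence of the averaged iterates *)

Theorem mainTheorem3 (R : realType) (m n : nat) (hm : (2 <= m)%N) (hn : (1 <= n)%N)
    (Y : set 'rV[R]_n) (Yclosed : closed Y) (Yconvex : convex_set Y)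
    (f : 'I_m -> 'rV[R]_n -> R)
    (fstrict : forall i, strictly_convex (f i))
    (fclosed : forall i, closed_function (f i))
    (fdiff : forall i x, differentiable (f i) x)
    (D : R) (hD : 0 <= D) :
  (exists rho1 : R -> R,
    [/\ forall e, 0 <= e -> 0 <= rho1 e,
        rho1 e @[e --> 0^'+] --> (0 : R) &
    forall (mu : 'I_m -> R) (mumin : R)
      (ystar : 'M[R]_(m, n)) (lambdastar : 'M[R]_(m.-1, n)),
    (forall i, 0 < mu i) ->
    (forall i, strongly_convex (mu i) (f i)) ->
    is_min_of mu mumin ->
    primal_optimal Y f ystar ->
    dual_optimal Y f lambdastar ->
    (objective f ystar)%:E = dual_function Y f lambdastar ->
    forall (eps : 'I_m -> R) (gamma : nat -> R) (r : nat -> 'M[R]_(m, n))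
      (lambda : nat -> 'M[R]_(m.-1, n)) (y : nat -> 'M[R]_(m, n)),
    inexact_dual_algorithm Y f gamma r lambda y ->
    (forall i k, enorm (row i (r k)) <= eps i) ->
    (forall k, 0 < gamma k <= (Lh m mumin)^-1) ->
    series gamma @ \oo --> +oo ->
    (forall k, enorm (lambda k - lambdastar) <= D) ->
    let err := running_min (fun k => enorm (block_average (y k) - ystar)) in
    let bound := rho1 (total_distortion eps) in
    (limn_esup (fun k => (err k)%:E) <= bound%:E)%E /\
    (forall gamma0 p : R,
      0 < gamma0 <= (Lh m mumin)^-1 -> 0 <= p <= 1 ->
      (forall k, gamma k = gamma0 / k.+1%:R `^ p) ->
      exists C : R, \forall k \near \oo, err k <= C * rate p k + bound)]) /\
  (forall k, rate 0 k = (root4 k%:R)^-1 :> R) /\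
  (forall p : R, 0 < p <= 1 ->
    (fun k : nat => ((root4 k%:R)^-1)%R : R) =o_\oo (fun k : nat => rate p k)).
Proof.
split; last by split; [exact: rate0 | exact: rate0_littleo].
(* [rho1] is chosen before [mu], so it uses one fixed modulus [s0] of the
   objective, and the estimate is applied with the better of [s0] and [mumin]. *)
have [s0 [s0_gt0 s0P]] : exists s0, 0 < s0 /\ forall s, 0 < s ->
    sconvex s (objective f) ->
    exists s', [/\ s <= s', s0 <= s' & sconvex s' (objective f)].
  have [[s0 [s0_gt0 fs0]]|nos] :=
      pselect (exists s, 0 < s /\ sconvex s (objective f)); last first.
    (* With no positive modulus available the second clause is vacuous, and 1 is a placeholder. *)
    by exists 1; split=> // s s_gt0 fs; exfalso; apply: nos; exists s.
  exists s0; split=> // s s_gt0 fs.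
  by case: (leP s s0) => [|/ltW] ss0; [exists s0 | exists s]; split.
exists (fun e => Num.sqrt (4 * e * D / s0 + 3 * e ^+ 2)); split.
- by move=> e _; exact: sqrtr_ge0.
- apply: cvg_at_right_filter.
  rewrite -[X in _ --> X](sqrtr0 R).
  rewrite -[X in Num.sqrt X](_ : 4 * 0 * D / s0 + 3 * 0 ^+ 2 = 0); last by ring.
  apply: (continuous_cvg _ (@sqrt_continuous R _)); apply: cvgD.
    by apply: cvgMl; apply: cvgMl; apply: cvgMr; exact: cvg_id.
  by apply: cvgMr; rewrite !expr2; apply: cvgM; exact: cvg_id.
move=> mu mumin ystar lambdastar mu_gt0 fmu [[i0 mumin_i0] mumin_le] yopt _ dual.
move=> eps gamma r lambda y algo r_eps gammaP gamma_oo lambda_D err bound.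
have mumin_gt0 : 0 < mumin by rewrite mumin_i0.
have [s [mumin_s s0_s fs]] := s0P _ mumin_gt0 (objective_sconvex fmu mumin_le).
have s_gt0 : 0 < s := lt_le_trans s0_gt0 s0_s.
have [_ Ay0 _] := yopt; have ymin := strong_duality_argmin yopt dual.
have r_le k := enorm_opA_le_total_distortion (fun i => r_eps i k).
have gamma_gt0 k : 0 < gamma k by case/andP: (gammaP k).
(* The stepsize bound gives [mumin] on the right, and [mumin <= s]. *)
have gamma_le k : gamma k * (2 + 2 * cos (pi / m%:R)) <= s.
  have c_gt0 : 0 < 2 + 2 * cos (pi / m%:R) :> R.
    by have := cos_pi_div_ge0 R hm; lra.
  case/andP: (gammaP k) => _; rewrite /Lh invfM invrK ler_pdivlMr //.
  by move=> /le_trans; apply.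
have e_ge0 : 0 <= total_distortion eps by exact: sqrtr_ge0.
set a := Num.sqrt (2 * D ^+ 2 / s).
have err_le k : err k <= a / Num.sqrt (series gamma k.+1) + bound.
  apply: le_trans (running_min_le_sqrt hm Yconvex s_gt0 fs ymin Ay0 algo r_le
    gamma_gt0 gamma_le lambda_D k) _.
  (* The squared error level decreases with the modulus, so [s0 <= s] allows replacing [s] by
     [s0]. *)
  rewrite lerD2l ler_wsqrtr // lerD2r ler_wpM2l ?mulr_ge0 //.
  by rewrite lef_pV2 ?posrE.
split.
  apply: limn_esup_le => e e_gt0.
  have := div_sqrt_cvg0 (sqrtr_ge0 (2 * D ^+ 2 / s)) gamma_oo e_gt0.
  apply: filterS => k ae; apply: le_trans (err_le k) _.
  by rewrite addrC lerD2l.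
(* The constant comes from [gamma0 * stepsum p k <= series gamma k.+1]. *)
move=> gamma0 p /andP[gamma0_gt0 _] p01 gammaE; exists (a / Num.sqrt gamma0).
near=> k; apply: le_trans (err_le k) _; rewrite lerD2r.
have k0 : (0 < k)%N by near: k; exact: nbhs_infty_gt.
have S1 : 1 <= stepsum p k by near: k; exact: stepsum_ge1.
have S0 : 0 < stepsum p k by exact: lt_le_trans ltr01 S1.
have gS : gamma0 * stepsum p k <= series gamma k.+1.
  apply: le_trans (ler_wpM2l (ltW gamma0_gt0) (stepsum_le_series p01 k0)) _.
  rewrite /series /= mulr_sumr le_eqVlt; apply/orP; left; apply/eqP.
  by apply: eq_bigr => i _; rewrite gammaE.
rewrite -mulrA ler_wpM2l ?sqrtr_ge0 // rateE -invfM.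
rewrite lef_pV2 ?posrE ?mulr_gt0 ?sqrtr_gt0 ?root4_gt0 //; last first.
  by apply: lt_le_trans gS; exact: mulr_gt0.
apply: le_trans (ler_wsqrtr gS); rewrite sqrtrM ?(ltW gamma0_gt0) // ler_wpM2l ?sqrtr_ge0 //.
exact: root4_le_sqrt.
Unshelve. all: by end_near. Qed.
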